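(* A basic system $(\Phi,i,j)$ must be one of the following: (1) $(A_1,1,1)$, $(A_2,1,1)$, $(A_2,1,2)$, $(A_2,2,1)$, $(A_2,2,2)$, $(A_3,2,2)$; (2) $(B_2,1,1)$, $(B_2,1,2)$, $(B_2,2,1)$, $(B_2,2,2)$, $(B_3,2,2)$, $(B_3,2,3)$, $(B_3,3,2)$, $(B_4,3,3)$; (3) $(C_2,1,1)$, $(C_2,1,2)$, $(C_2,2,1)$, $(C_2,2,2)$, $(C_3,2,2)$, $(C_3,2,3)$, $(C_3,3,2)$, $(C_4,3,3)$; (4) $(D_4,2,2)$, $(D_5,3,3)$; (5) $(E_6,4,4)$, $(E_7,4,4)$, $(E_7,4,5)$, $(E_7,5,4)$, $(E_8,3,4)$, $(E_8,4,3)$, $(E_8,4,4)$, $(E_8,4,5)$, $(E_8,5,4)$, $(E_8,5,5)$; (6) $(F_4,2,2)$, $(F_4,2,3)$, $(F_4,3,2)$, $(F_4,3,3)$; (7) $(G_2,1,1)$, $(G_2,1,2)$, $(G_2,2,1)$, $(G_2,2,2)$.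
   Context: Let $\Phi$ be an irreducible root system with Weyl group $W$, positive system $\Phi^+$ and simple roots $\Delta=\{\alpha_1,\dots,\alpha_n\}$ numbered in the standard (Bourbaki/Humphreys) way; $\langle\cdot,\cdot\rangle$ is the invariant form and $\alpha^\vee=2\alpha/\langle\alpha,\alpha\rangle$. A weight $\lambda$ is integral if $\langle\lambda,\alpha^\vee\rangle\in\mathbb Z$ for all $\alpha\in\Phi$; for integral $\lambda$, $\overline\lambda$ denotes the unique dominant weight in $W\lambda$. For $1\le i,j\le n$ let $I=\Delta\setminus\{\alpha_i\}$ and $J=\Delta\setminus\{\alpha_j\}$. A basic weight of $(\Phi,i,j)$ is an integral weight $\lambda$ with $\langle\lambda,\alpha^\vee\rangle\in\mathbb Z_{>0}$ for all $\alpha\in I$ and $\{\alpha\in\Delta:\langle\overline\lambda,\alpha\rangle=0\}=J$. The triple $(\Phi,i,j)$ is called a basic system if it has at least one basic weight. *)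

(* Defs.v *)
From HB Require Import structures.
From mathcomp Require Import all_boot all_order all_algebra.
From Stdlib Require List.
Set Implicit Arguments. Unset Strict Implicit. Unset Printing Implicit Defensive.
Import Order.TTheory GRing.Theory Num.Theory.
Local Open Scope ring_scope.

(* Irreducible (reduced, finite) root systems, given by their Cartan type,
   with Bourbaki numbering of simple roots. *)
Inductive cartan_type :=
  | TA of nat | TB of nat | TC of nat | TD of nat
  | TE6 | TE7 | TE8 | TF4 | TG2.

Definition rank (t : cartan_type) : nat :=
  match t with
  | TA n | TB n | TC n | TD n => n
  | TE6 => 6 | TE7 => 7 | TE8 => 8 | TF4 => 4 | TG2 => 2
  end.

Definition valid_type (t : cartan_type) : bool :=
  match t with
  | TA n => (1 <= n)%N
  | TB n => (2 <= n)%N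
  | TC n => (2 <= n)%N
  | TD n => (4 <= n)%N
  | _ => true
  end.

Definition adjn (k l : nat) : bool := (k == l.+1) || (l == k.+1).

(* Gram matrix (alpha_k, alpha_l) of the simple roots, 1-based indices,
   normalized so that the shortest roots have squared length 2. *)
Definition gram (t : cartan_type) (k l : nat) : int :=
  match t with
  | TA n => if k == l then 2 else if adjn k l then -1 else 0
  | TB n => if k == l then (if (k < n)%N then 4 else 2)
            else if adjn k l then -2 else 0
  | TC n => if k == l then (if (k < n)%N then 2 else 4)
            else if adjn k l then (if maxn k l == n then -2 else -1) else 0
  | TD n => if k == l then 2
            else if (adjn k l && (maxn k l <= n.-1)%N)
                    || ((minn k l == n.-2) && (maxn k l == n)) then -1 else 0
  | TE6 | TE7 | TE8 =>
      if k == l then 2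
      else if [|| (minn k l == 1%N) && (maxn k l == 3%N),
                  (minn k l == 2%N) && (maxn k l == 4%N) |
                  adjn k l && (3 <= minn k l)%N] then -1 else 0
  | TF4 => if k == l then (if (k <= 2)%N then 4 else 2)
           else if adjn k l then (if (maxn k l <= 3)%N then -2 else -1) else 0
  | TG2 => if k == l then (if k == 1%N then 2 else 6) else -3
  end.

Section RootSystem.
Variable R : realFieldType.
Variable t : cartan_type.
Local Notation n := (rank t).

(* The Euclidean space V = span of the simple roots; vectors are written in
   the basis of simple roots alpha_1..alpha_n (0-based ordinal k <-> alpha_{k+1}). *)
Definition ip (x y : 'rV[R]_n) : R :=
  \sum_(k < n) \sum_(l < n) x 0 k * y 0 l * (gram t k.+1 l.+1)%:~R.

Definition simple (k : 'I_n) : 'rV[R]_n := \row_(l < n) (l == k)%:R.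

Definition pair (x a : 'rV[R]_n) : R := 2 * ip x a / ip a a.

Definition refl (k : 'I_n) (x : 'rV[R]_n) : 'rV[R]_n :=
  x - pair x (simple k) *: simple k.

Definition weyl_act (s : seq 'I_n) (x : 'rV[R]_n) : 'rV[R]_n := foldr refl x s.

Definition in_orbit (x y : 'rV[R]_n) : Prop := exists s, y = weyl_act s x.

Definition is_root (a : 'rV[R]_n) : Prop := exists k, in_orbit (simple k) a.

Definition integral (lam : 'rV[R]_n) : Prop :=
  forall a, is_root a -> exists z : int, pair lam a = z%:~R.

Definition dominant (mu : 'rV[R]_n) : Prop :=
  forall k : 'I_n, 0 <= pair mu (simple k).

Definition basic_weight (i j : nat) (lam : 'rV[R]_n) : Prop :=
  [/\ integral lam,
      (forall k : 'I_n, k.+1 != i -> 0 < pair lam (simple k)) &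
      exists mu, [/\ in_orbit lam mu, dominant mu &
        forall k : 'I_n, ip mu (simple k) = 0 <-> k.+1 != j]].

Definition basic_system (i j : nat) : Prop := exists lam, basic_weight i j lam.

End RootSystem.

Definition basic_list : list (cartan_type * nat * nat) :=
  [:: (TA 1, 1, 1); (TA 2, 1, 1); (TA 2, 1, 2); (TA 2, 2, 1); (TA 2, 2, 2); (TA 3, 2, 2);
      (TB 2, 1, 1); (TB 2, 1, 2); (TB 2, 2, 1); (TB 2, 2, 2); (TB 3, 2, 2); (TB 3, 2, 3);
      (TB 3, 3, 2); (TB 4, 3, 3);
      (TC 2, 1, 1); (TC 2, 1, 2); (TC 2, 2, 1); (TC 2, 2, 2); (TC 3, 2, 2); (TC 3, 2, 3);
      (TC 3, 3, 2); (TC 4, 3, 3);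
      (TD 4, 2, 2); (TD 5, 3, 3);
      (TE6, 4, 4); (TE7, 4, 4); (TE7, 4, 5); (TE7, 5, 4); (TE8, 3, 4); (TE8, 4, 3);
      (TE8, 4, 4); (TE8, 4, 5); (TE8, 5, 4); (TE8, 5, 5);
      (TF4, 2, 2); (TF4, 2, 3); (TF4, 3, 2); (TF4, 3, 3);
      (TG2, 1, 1); (TG2, 1, 2); (TG2, 2, 1); (TG2, 2, 2)]%N.

(* Main.v *)
Require Import Defs.
From HB Require Import structures.
From mathcomp Require Import all_boot all_order all_algebra.
From mathcomp Require Import zify ring lra.
From Stdlib Require List.
Set Implicit Arguments. Unset Strict Implicit. Unset Printing Implicit Defensive.
Import Order.TTheory GRing.Theory Num.Theory.
Local Open Scope ring_scope.

(** A basic weight [lam] is, up to the positive scalar [m], a Weyl conjugate of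
    the fundamental weight [omega_j] that is strictly dominant for
    [I = Delta \ {alpha_i}].  Everything is read off the vector of labels
    [<lam, alpha_k^vee>], on which the simple reflections act by the Cartan
    matrix.

    In the classical types the conjugates of [m * omega_j] have, in the standard
    coordinates, at most two (type A) or three (types B, C, D: [c], [0], [-c])
    distinct entries, while strict dominance for [I] forces a long strictly
    decreasing run of coordinates; this bounds the rank.  The remaining classical
    cases, F4 and G2 are settled by enumerating the orbit of [omega_j].

    For E6, E7, E8 the labels of [lam / m] are integers, hence at least 1 on [I],
    and the inverse Cartan matrix of [I] has nonnegative entries, so the
    projection of [lam / m] to the span of [I] has norm at least [|rho_I|].  Thus
    [|rho_I|^2 <= |omega_j|^2], which leaves exactly the listed pairs. *)

(** * Cartan integers and the Weyl group action on labels *)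

(** Indices are 0-based. For indices below the rank the division is exact, by [cartan_mul_gram]. *)
Definition cartan (t : cartan_type) (k l : nat) : int :=
  ((2 * gram t k.+1 l.+1) %/ gram t l.+1 l.+1)%Z.

Lemma gram_diag_gt0 t k : 0 < gram t k k.
Proof. by case: t => [n|n|n|n|||||] /=; rewrite eqxx //; case: ifP. Qed.

Lemma cartan_mul_gram t (k l : 'I_(rank t)) :
  cartan t k l * gram t l.+1 l.+1 = 2 * gram t k.+1 l.+1.
Proof.
have := (ltn_ord k, ltn_ord l); move: (k : nat) (l : nat) => {}k {}l [].
rewrite /cartan; case: t => [n|n|n|n|||||] /=; rewrite eqxx ?eqSS => kn ln.
all: case: (eqVneq k l) => [kl|nkl] //=; rewrite ?kl //.
all: repeat case: ifP => //.
all: rewrite /adjn; lia.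
Qed.

Section Labels.
Variables (R : realFieldType) (t : cartan_type).
Local Notation n := (rank t).
Implicit Types (x v : 'rV[R]_n) (k l : 'I_n).

Definition labels x : 'rV[R]_n := \row_k pair x (simple R k).

Definition refl_labels (k : 'I_n) v : 'rV[R]_n :=
  \row_l (v 0 l - v 0 k * (cartan t k l)%:~R).

Lemma ip_simple x l : ip x (simple R l) = \sum_k x 0 k * (gram t k.+1 l.+1)%:~R.
Proof.
rewrite /ip; apply: eq_bigr => k _; rewrite (bigD1 l) //= big1 => [|p pl].
  by rewrite mxE eqxx mulr1 addr0.
by rewrite mxE (negPf pl) mulr0 mul0r.
Qed.

Lemma ip_simple2 k l : ip (simple R k : 'rV_n) (simple R l) = (gram t k.+1 l.+1)%:~R.
Proof.
rewrite ip_simple (bigD1 k) //= big1 => [|p pk].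
  by rewrite mxE eqxx mul1r addr0.
by rewrite mxE (negPf pk) mul0r.
Qed.

Lemma gram_neq0 (l : nat) : (gram t l l)%:~R != 0 :> R.
Proof. by rewrite intr_eq0 gt_eqF ?gram_diag_gt0. Qed.

Lemma pair_simple k l : pair (simple R k : 'rV_n) (simple R l) = (cartan t k l)%:~R.
Proof.
rewrite /pair !ip_simple2; apply: (mulIf (gram_neq0 l.+1)).
by rewrite divfK ?gram_neq0 // -[2]/(2%:~R) -!intrM cartan_mul_gram.
Qed.

Lemma pairB_simple x a k l :
  pair (x - a *: simple R k) (simple R l) =
  pair x (simple R l) - a * (cartan t k l)%:~R.
Proof.
rewrite /pair; have -> : ip (x - a *: simple R k) (simple R l) =
          ip x (simple R l) - a * ip (simple R k : 'rV_n) (simple R l).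
  rewrite !ip_simple mulr_sumr -sumrB; apply: eq_bigr => p _.
  by rewrite !mxE; ring.
rewrite -pair_simple /pair; ring.
Qed.

Lemma labels_refl k x : labels (refl k x) = refl_labels k (labels x).
Proof. by apply/rowP => l; rewrite !mxE pairB_simple. Qed.

Lemma reflK k : involutive (refl k : 'rV[R]_n -> _).
Proof.
move=> x; rewrite {1}/refl {1}/refl pairB_simple.
have -> : cartan t k k = 2.
  by apply: (mulIf (lt0r_neq0 (gram_diag_gt0 t k.+1))); rewrite cartan_mul_gram.
by rewrite /refl -addrA -opprD -scalerDl; set p := pair _ _;
  rewrite (_ : p + (p - p * 2%:~R) = 0) ?scale0r ?subr0 //; ring.
Qed.

Lemma weyl_act_rev s x : weyl_act (rev s) (weyl_act s x) = x.
Proof.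
elim: s => //= k s IHs; rewrite /weyl_act rev_cons foldr_rcons /=.
by rewrite reflK; exact: IHs.
Qed.

(** Impredicative form of the orbit of [m * omega_j] in label coordinates: it is used by supplying
    an invariant [P]. *)
Definition label_orbit (m : R) (j : nat) v : Prop :=
  forall P : 'rV[R]_n -> Prop,
    P (\row_k (m *+ (k.+1 == j))) ->
    (forall k w, P w -> P (refl_labels k w)) -> P v.

Lemma basic_system_labels i j : (1 <= j <= n)%N -> basic_system R t i j ->
  exists2 m, 0 < m & exists2 v, label_orbit m j v &
    forall k : 'I_n, k.+1 != i -> 0 < v 0 k.
Proof.
move=> /andP[j_gt0 j_len] [lam [_ lam_pos [mu [[s def_mu] mu_dom mu_ip]]]].
have jP : (j.-1 < n)%N by rewrite prednK.
pose jo := Ordinal jP; have joS : jo.+1 = j by rewrite /= prednK.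
have mu0 k : k.+1 != j -> pair mu (simple R k) = 0.
  by move=> /mu_ip E; rewrite /pair E mulr0 mul0r.
(* The scalar is the only nonzero label of the dominant conjugate [mu]; it is positive because [mu]
   is dominant. *)
exists (pair mu (simple R jo)).
  rewrite lt_neqAle mu_dom andbT eq_sym /pair !mulf_eq0 invr_eq0 ip_simple2.
  rewrite (negPf (gram_neq0 _)) orbF pnatr_eq0 /=.
  by apply/eqP => /mu_ip; rewrite joS eqxx.
exists (labels lam) => [|k ki]; last by rewrite mxE lam_pos.
(* The word [s] leads from [lam] to [mu]; the reversed word leads back. *)
move=> P P0 Pr; rewrite -(weyl_act_rev s lam) -def_mu.
elim: (rev s) => [|k s' IHs] /=; last by rewrite labels_refl; apply: Pr.
suff -> : labels mu = \row_k (pair mu (simple R jo) *+ (k.+1 == j)) by [].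
apply/rowP => k; rewrite !mxE; case: eqVneq => [kj|/mu0//].
by congr (pair _ (simple _ _)); apply: val_inj; rewrite /= -kj.
Qed.

End Labels.

(** * Exclusion by enumerating an orbit *)

Definition refl_seq (t : cartan_type) (s : seq int) (k : nat) : seq int :=
  mkseq (fun l => s`_l - s`_k * cartan t k l) (rank t).

Definition fund_seq (t : cartan_type) (j : nat) : seq int :=
  mkseq (fun k => (k.+1 == j)%:R) (rank t).

Fixpoint explore (t : cartan_type) (fuel : nat) (todo seen : seq (seq int)) :=
  match fuel, todo with
  | fuel'.+1, s :: todo' =>
      if s \in seen then explore t fuel' todo' seen
      else explore t fuel' (map (refl_seq t s) (iota 0 (rank t)) ++ todo')
             (s :: seen)
  | _, _ => seen
  end.

(* The fuel suffices for all ranks used below; the closure test makes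
   [orbit_excludes] sound whatever [explore] returns. *)
Definition orbit_excludes (t : cartan_type) (i j : nat) : bool :=
  let L := explore t 1000 [:: fund_seq t j] [::] in
  [&& fund_seq t j \in L,
      all (fun s => all (fun k => refl_seq t s k \in L) (iota 0 (rank t))) L &
      all (fun s => has (fun k => (k.+1 != i) && (s`_k <= 0))
                        (iota 0 (rank t))) L].

(** A list that contains [omega_j] and is closed under reflections contains the whole orbit, up to
    the scalar [m]. Each member has a nonpositive label away from [i]. *)
Lemma orbit_excludes_sound (R : realFieldType) t i j :
  (1 <= j <= rank t)%N -> orbit_excludes t i j -> ~ basic_system R t i j.
Proof.
rewrite /orbit_excludes; move: (explore _ _ _ _) => L j_in.
case/and3P => fundL /allP closedL /allP badL.
case/(basic_system_labels j_in) => m m_gt0 [v v_orbit v_pos].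
have [||s sL def_v] := v_orbit (fun w => exists2 s, s \in L &
    forall k, w 0 k = m * (s`_k)%:~R).
- exists (fund_seq t j) => // k.
  by rewrite mxE nth_mkseq // rmorph_nat mulr_natr.
- move=> k w [s sL def_w]; exists (refl_seq t s k).
    by apply: (allP (closedL s sL)); rewrite mem_iota /=.
  by move=> l; rewrite mxE nth_mkseq // !def_w rmorphB rmorphM; ring.
have /hasP[k] := badL s sL.
rewrite mem_iota /= => kn /andP[ki]; apply/negP; rewrite -ltNge.
by have := v_pos (Ordinal kn) ki; rewrite def_v pmulr_rgt0 // ltr0z.
Qed.

(** * Exclusion by comparing norms *)

Definition sumz (n : nat) (F : nat -> int) : int :=
  foldr (fun k a => F k + a) 0 (iota 0 n).

Lemma sumzE n F : sumz n F = \sum_(k < n) F k.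
Proof.
rewrite -(big_mkord xpredT F) /sumz /index_iota subn0.
by elim: (iota 0 n) => [|k s IHs]; rewrite ?big_nil // big_cons -IHs.
Qed.

(* Here [i] and [j] are 0-based.  [G] is [d] times the inverse Cartan matrix, that
   is, [d] times the invariant form in label coordinates, and
   [G i i * G k l - G i k * G i l] is, up to the factor [d * G i i], the inverse
   Cartan matrix of [I] bordered by zeros.  So the last test says
   [|omega_j|^2 < |rho_I|^2]. *)
Definition norm_excludes (t : cartan_type) (d : int) (g : seq (seq int))
    (i j : nat) : bool :=
  let G k l := (nth [::] g k)`_l in
  let ks := iota 0 (rank t) in
  [&& all (fun k => all (fun l => G k l == G l k) ks) ks,
      all (fun k => all (fun l =>
        sumz (rank t) (fun p => cartan t k p * G p l) == d *+ (k == l)) ks) ks,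
      all (fun k => cartan t k k == 2) ks,
      all (fun k => all (fun l => 0 <= G i i * G k l - G i k * G i l) ks) ks &
      G i i * G j j <
        sumz (rank t) (fun k => sumz (rank t) (fun l =>
          G i i * G k l - G i k * G i l))].

Section NormBound.
Variables (R : realFieldType) (n : nat) (G : 'M[R]_n).
Hypothesis G_sym : G^T = G.

Definition qform (v : 'rV[R]_n) : R := (v *m G *m v^T) 0 0.

Lemma qformE v : qform v = \sum_k \sum_l G k l * v 0 k * v 0 l.
Proof.
rewrite /qform mxE exchange_big; apply: eq_bigr => l _.
rewrite !mxE mulr_suml; apply: eq_bigr => k _; ring.
Qed.

(** Here [r] stands for the labels of [alpha_k]. The two cross terms contribute [- 2 * d * v_k ^ 2],
    and the square term [d * r_k * v_k ^ 2] cancels them since [r_k = 2]. *)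
Lemma qform_reflection d (r v : 'rV[R]_n) k :
  r *m G = d *: delta_mx 0 k -> r 0 k = 2 ->
  qform (v - v 0 k *: r) = qform v.
Proof.
move=> rG rk; have Gr : G *m r^T = d *: delta_mx k 0.
  by rewrite -{1}G_sym -trmx_mul rG linearZ /= trmx_delta.
have dot (w : 'rV[R]_n) : delta_mx 0 k *m w^T = (w 0 k)%:M.
  by apply/matrixP => a b; rewrite !ord1 -rowE !mxE.
have dot' (w : 'rV[R]_n) : w *m delta_mx k 0 = (w 0 k)%:M.
  by apply/matrixP => a b; rewrite !ord1 -colE !mxE.
rewrite /qform; have -> : (v - v 0 k *: r)^T = v^T - v 0 k *: r^T.
  by rewrite linearB linearZ.
rewrite mulmxBl -scalemxAl rG mulmxBl !mulmxBr.
rewrite -!scalemxAr -!scalemxAl -[v *m G *m r^T]mulmxA Gr -!scalemxAr.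
rewrite !dot dot' rk !mxE; ring.
Qed.

Lemma qform_ge i m (v : 'rV[R]_n) : 0 <= m ->
  (forall k l, 0 <= G i i * G k l - G i k * G i l) ->
  (forall k, k != i -> m <= v 0 k) ->
  m ^+ 2 * (\sum_k \sum_l (G i i * G k l - G i k * G i l)) <= G i i * qform v.
Proof.
move=> m_ge0 H_ge0 v_ge.
have Gsym k l : G k l = G l k by rewrite -{1}G_sym mxE.
(* Completing the square splits off the component along [omega_i]; the rest is the projection to the
   span of [I]. *)
have -> : G i i * qform v = (\sum_k G i k * v 0 k) ^+ 2 +
    \sum_k \sum_l (G i i * G k l - G i k * G i l) * (v 0 k * v 0 l).
  rewrite qformE expr2 big_distrlr /= -big_split mulr_sumr /=.
  apply: eq_bigr => k _; rewrite mulr_sumr -big_split /=.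
  by apply: eq_bigr => l _; ring.
rewrite ler_wpDl ?sqr_ge0 // mulr_sumr ler_sum // => k _.
rewrite mulr_sumr ler_sum // => l _; rewrite [m ^+ 2 * _]mulrC.
(* Row and column [i] of the remaining form vanish, so the unconstrained label [v 0 i] does not
   matter. *)
have [->|ki] := eqVneq k i; first by rewrite subrr !mul0r.
have [->|li] := eqVneq l i; first by rewrite (Gsym k i) [G i k * G i i]mulrC subrr !mul0r.
by rewrite ler_wpM2l // expr2 ler_pM ?v_ge.
Qed.
End NormBound.

Lemma norm_excludes_sound (R : realFieldType) t d g i j :
  (1 <= i <= rank t)%N -> (1 <= j <= rank t)%N ->
  norm_excludes t d g i.-1 j.-1 -> ~ basic_system R t i j.
Proof.
move=> /andP[i_gt0 i_len] j_in; have /andP[j_gt0 j_len] := j_in.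
have iP : (i.-1 < rank t)%N by rewrite prednK.
have jP : (j.-1 < rank t)%N by rewrite prednK.
pose io := Ordinal iP; pose jo := Ordinal jP.
pose G k l := (nth [::] g k)`_l; pose M : 'M[R]_(rank t) := \matrix_(k, l) (G k l)%:~R.
have ords (P : pred nat) : all P (iota 0 (rank t)) -> forall k : 'I_(rank t), P k.
  by move=> /allP h k; apply: h; rewrite mem_iota /=.
rewrite /norm_excludes -/G => /and5P[].
move=> /ords Gsym /ords CG /ords C2 /ords H_ge0 lt_norm.
case/(basic_system_labels j_in) => m m_gt0 [v v_orbit v_pos].
have Msym : M^T = M.
  by apply/matrixP => k l; rewrite !mxE; congr (_%:~R); apply/eqP; apply: (ords _ (Gsym l)).
(* The invariant: labels are integer multiples of [m], and the norm is that of [m * omega_j]. *)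
have [||v_int v_norm] := v_orbit (fun w =>
    (forall k, exists z : int, w 0 k = m * z%:~R) /\
    qform M w = m ^+ 2 * M jo jo).
- split=> [k|]; first by exists (k.+1 == j)%:R; rewrite mxE rmorph_nat mulr_natr.
  rewrite qformE (bigD1 jo) //= [X in _ + X]big1 => [|k kj].
    rewrite (bigD1 jo) //= big1 => [|l lj].
      by rewrite !mxE /= prednK // eqxx mulr1n; ring.
    rewrite !mxE -[X in l.+1 == X](prednK j_gt0) eqSS.
    by rewrite (negPf (lj : l != j.-1 :> nat)) mulr0n mulr0.
  rewrite big1 // => l _; rewrite !mxE -[X in k.+1 == X](prednK j_gt0) eqSS.
  by rewrite (negPf (kj : k != j.-1 :> nat)) mulr0n mulr0 mul0r.
- move=> k w [w_int w_norm]; split=> [l|].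
    have [[a def_a] [b def_b]] := (w_int l, w_int k).
    exists (a - b * cartan t k l).
    by rewrite mxE def_a def_b rmorphB rmorphM; ring.
  pose r : 'rV[R]_(rank t) := \row_l (cartan t k l)%:~R.
  have -> : refl_labels k w = w - w 0 k *: r by apply/rowP => l; rewrite !mxE.
  rewrite (@qform_reflection _ _ _ Msym d%:~R) //.
    apply/rowP => l; rewrite !mxE.
    have /eqP E : _ == d *+ (k == l) := ords _ (CG k) l.
    rewrite [RHS](_ : _ = (d *+ (k == l))%:~R); last first.
      by rewrite rmorphMn /= ?eqxx eq_sym mulr_natr.
    rewrite -E sumzE rmorph_sum; apply: eq_bigr => p _.
    by rewrite !mxE -intrM.
  by rewrite mxE (eqP (C2 k)).
suff: m ^+ 2 * (\sum_k \sum_l (M io io * M k l - M io k * M io l)) <=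
      M io io * qform M v.
  rewrite v_norm mulrCA ler_pM2l ?exprn_gt0 // leNgt => /negP[].
  rewrite !mxE -intrM; under eq_bigr do under eq_bigr do rewrite !mxE -!intrM -intrB.
  rewrite (_ : \sum_(k < _) _ = (sumz (rank t) (fun k => sumz (rank t) (fun l =>
          G i.-1 i.-1 * G k l - G i.-1 k * G i.-1 l)))%:~R) ?ltr_int //.
  rewrite sumzE rmorph_sum; apply: eq_bigr => k _.
  by rewrite /= sumzE rmorph_sum.
apply: qform_ge => // [|k l|k ki]; first exact: ltW.
  by rewrite !mxE -!intrM -intrB ler0z; apply: (ords _ (H_ge0 k)).
(* A positive integer multiple of [m] is at least [m]. *)
have := v_pos k; have [z ->] := v_int k.
rewrite -(prednK i_gt0) eqSS => /(_ ki); rewrite pmulr_rgt0 // ltr0z.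
by move=> z_gt0; rewrite -[leLHS]mulr1 ler_pM2l // ler1z -gtz0_ge1.
Qed.

(** * Cartan integers of the classical types *)

Lemma cartan_A n k l :
  cartan (TA n) k l = if k == l then 2 else if adjn k l then -1 else 0.
Proof. by rewrite /cartan /= /adjn !eqSS eqxx; repeat case: ifP. Qed.

Lemma cartan_B n k l : (k < n)%N -> (l < n)%N -> cartan (TB n) k l =
  if k == l then 2 else
  if adjn k l then (if l.+1 == n then -2 else -1) else 0.
Proof.
move=> kn ln; rewrite /cartan /= /adjn !eqSS eqxx.
case: (eqVneq k l) => [->|nkl]; first by case: ifP.
by repeat case: ifP => //; lia.
Qed.

Lemma cartan_C n k l : (k < n)%N -> (l < n)%N -> cartan (TC n) k l =
  if k == l then 2 else
  if adjn k l then (if k.+1 == n then -2 else -1) else 0.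
Proof.
move=> kn ln; rewrite /cartan /= /adjn !eqSS eqxx.
case: (eqVneq k l) => [->|nkl]; first by case: ifP.
by repeat case: ifP => //; lia.
Qed.

Lemma cartan_D n k l : cartan (TD n) k l = gram (TD n) k.+1 l.+1.
Proof. by rewrite /cartan /= eqxx; repeat case: ifP. Qed.

Ltac decide_ifs :=
  repeat match goal with |- context [if ?b then _ else _] =>
    first [rewrite (_ : b = true); last lia | rewrite (_ : b = false); last lia
          | case: (boolP b) => ?]
  end.

Definition swap_at (T : Type) (k : nat) (y : nat -> T) (p : nat) : T :=
  if p == k then y k.+1 else if p == k.+1 then y k else y p.

Definition opp_at (V : zmodType) (k : nat) (y : nat -> V) (p : nat) : V :=
  if p == k then - y p else y p.

(** Swapping coordinates [k] and [k.+1] can change the difference [y l - y l.+1] only in the first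
    three cases. *)
Lemma nat_near_cases k l :
  [\/ l = k, l = k.+1, k = l.+1 | ((l.+1 < k) || (k.+1 < l))%N].
Proof.
have [lt_lk|lt_kl|->] := ltngtP l k; last exact: Or41.
  have [->|?] := eqVneq k l.+1; first exact: Or43.
  by apply: Or44; lia.
have [->|?] := eqVneq l k.+1; first exact: Or42.
by apply: Or44; lia.
Qed.

(** * Classical orbits in standard coordinates *)

Section Coordinates.
Variable R : realFieldType.
Implicit Types (y : nat -> R) (c m : R).

Lemma label_orbit_A n m j (v : 'rV[R]_(rank (TA n))) : label_orbit m j v ->
  exists2 y : nat -> R, (forall k, v 0 k = y k - y k.+1) &
    forall p, y p = m \/ y p = 0.
Proof.
move=> v_orb; pattern v; apply: v_orb => [|k w [y def_w val_y]].
  (* This is [m * omega_j] up to a multiple of the all-ones vector, which the labels do not see. *)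
  exists (fun p => if (p < j)%N then m else 0) => [k|p]; last by case: ifP; auto.
  rewrite mxE; move: (k : nat) => {}k.
  by case: (eqVneq k.+1 j) => kj; decide_ifs; rewrite ?mulr1n ?mulr0n; ring.
exists (swap_at k y) => [l|p]; last by rewrite /swap_at; repeat case: ifP => _.
rewrite mxE !def_w cartan_A; move: (k : nat) (l : nat) => {}k {}l.
rewrite /swap_at /adjn.
by case: (nat_near_cases k l) => [->|->|->|far]; decide_ifs; ring.
Qed.

Definition ternary c y := forall p, [\/ y p = c, y p = 0 | y p = - c].

Lemma ternary_swap_at c k y : ternary c y -> ternary c (swap_at k y).
Proof. by move=> ty p; rewrite /swap_at; repeat case: ifP => _. Qed.

Lemma ternary_opp_at c k y : ternary c y -> ternary c (opp_at k y).
Proof.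
move=> ty p; rewrite /opp_at; case: ifP => // _.
by case: (ty p) => ->; rewrite ?oppr0 ?opprK; [apply: Or33|apply: Or32|apply: Or31].
Qed.

Lemma label_orbit_B n m j (v : 'rV[R]_(rank (TB n))) :
  (1 <= j <= n)%N -> label_orbit m j v ->
  exists2 y : nat -> R, (forall k, v 0 k = if k.+1 == n then 2 * y k else y k - y k.+1) &
    exists c, ternary c y.
Proof.
move=> j_in v_orb; pattern v; apply: v_orb => [|k w [y def_w [c ty]]].
  (* The last label is twice the last coordinate, so all coordinates of [omega_n] are one half. *)
  pose c := if j == n then m / 2 else m.
  exists (fun p => if (p < j)%N then c else 0) => [k|]; last first.
    by exists c => p; case: ifP => _; [apply: Or31|apply: Or32].
  rewrite mxE /c; move: (ltn_ord k) j_in => /=; move: (k : nat) => {}k kn j_in.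
  by case: (eqVneq k.+1 j) => kj; decide_ifs; rewrite ?mulr1n ?mulr0n; field.
exists (if k.+1 == n then opp_at k y else swap_at k y); last first.
  by exists c; case: ifP => _; [apply: ternary_opp_at|apply: ternary_swap_at].
move=> l; rewrite mxE !def_w cartan_B //.
move: (ltn_ord k) (ltn_ord l) => /=; move: (k : nat) (l : nat) => {def_w}k {}l kn ln.
rewrite /swap_at /opp_at /adjn.
case: (nat_near_cases k l) => [?|?|?|far]; [subst l|subst l|subst k|];
  decide_ifs; ring.
Qed.

Lemma label_orbit_C n m j (v : 'rV[R]_(rank (TC n))) :
  (1 <= j <= n)%N -> label_orbit m j v ->
  exists2 y : nat -> R,
    (forall k, v 0 k = if k.+1 == n then y k else y k - y k.+1) &
    exists c, ternary c y.
Proof.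
move=> j_in v_orb; pattern v; apply: v_orb => [|k w [y def_w [c ty]]].
  exists (fun p => if (p < j)%N then m else 0) => [k|]; last first.
    by exists m => p; case: ifP => _; [apply: Or31|apply: Or32].
  rewrite mxE; move: (ltn_ord k) j_in => /=; move: (k : nat) => {}k kn j_in.
  by case: (eqVneq k.+1 j) => kj; decide_ifs; rewrite ?mulr1n ?mulr0n; ring.
exists (if k.+1 == n then opp_at k y else swap_at k y); last first.
  by exists c; case: ifP => _; [apply: ternary_opp_at|apply: ternary_swap_at].
move=> l; rewrite mxE !def_w cartan_C //.
move: (ltn_ord k) (ltn_ord l) => /=; move: (k : nat) (l : nat) => {def_w}k {}l kn ln.
rewrite /swap_at /opp_at /adjn.
case: (nat_near_cases k l) => [?|?|?|far]; [subst l|subst l|subst k|];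
  decide_ifs; ring.
Qed.

Lemma label_orbit_D n m j (v : 'rV[R]_(rank (TD n.+2))) :
  (1 <= j <= n.+2)%N -> label_orbit m j v ->
  exists2 y : nat -> R,
    (forall k, v 0 k = if k == n.+1 :> nat then y n + y n.+1 else y k - y k.+1) &
    exists c, ternary c y.
Proof.
move=> j_in v_orb; pattern v; apply: v_orb => [|k w [y def_w [c ty]]].
  (* The two half-spin weights, [j = n.+1] and [j = n.+2], have coordinates one half up to sign; the
     former has its last sign reversed. *)
  pose c := if (n < j)%N then m / 2 else m.
  exists (if j == n.+1 then opp_at n.+1 (fun=> c)
          else fun p => if (p < j)%N then c else 0) => [k|]; last first.
    exists c; case: ifP => _; last by move=> p; case: ifP => _; [apply: Or31|apply: Or32].
    by apply: ternary_opp_at => p; apply: Or31.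
  rewrite mxE /c /opp_at; move: (ltn_ord k) j_in => /=; move: (k : nat) => {}k kn j_in.
  case: (eqVneq k.+1 j) => kj; case: (eqVneq j n.+1) => jn; decide_ifs;
    by rewrite ?mulr1n ?mulr0n; field.
(* The last reflection swaps the last two coordinates and negates both. *)
exists (if k == n.+1 :> nat then opp_at n (opp_at n.+1 (swap_at n y))
        else swap_at k y); last first.
  exists c; case: ifP => _; last exact: ternary_swap_at.
  by do 2!apply: ternary_opp_at; apply: ternary_swap_at.
move=> l; rewrite mxE !def_w cartan_D /gram.
move: (ltn_ord k) (ltn_ord l) => /=; move: (k : nat) (l : nat) => {def_w}k {}l kn ln.
rewrite /swap_at /opp_at /adjn !eqSS.
case: (eqVneq k n.+1) => kn'; case: (eqVneq l n.+1) => ln'; subst.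
- decide_ifs; ring.
- case: (eqVneq l n) => ?; subst; first by decide_ifs; ring.
  case: (eqVneq l.+1 n) => ?; subst; decide_ifs; ring.
- case: (eqVneq k n) => ?; subst; first by decide_ifs; ring.
  case: (eqVneq k.+1 n) => ?; subst; decide_ifs; ring.
case: (nat_near_cases k l) => [?|?|?|far]; subst; decide_ifs; ring.
Qed.

(** * Rank bounds in the classical types *)

Lemma ternary_no_chain4 c y p : ternary c y ->
  y p.+1 < y p -> y p.+2 < y p.+1 -> y p.+3 < y p.+2 -> False.
Proof.
move=> ty; case: (ty p) (ty p.+1) (ty p.+2) (ty p.+3) => -> [] -> [] -> [] ->; lra.
Qed.

(** A positive entry equals [|c|], already the largest possible value. *)
Lemma ternary_no_chain2 c y p : ternary c y -> 0 < y p.+1 -> y p.+1 < y p -> False.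
Proof. move=> ty; case: (ty p) (ty p.+1) => -> [] ->; lra. Qed.

Lemma basic_system_A_rank n i j :
  (1 <= j <= n)%N -> basic_system R (TA n) i j -> (n <= 3)%N.
Proof.
move=> j_in /(basic_system_labels (t := TA n) j_in)[m m_gt0 [v v_orb v_pos]].
have [y def_v val_y] := label_orbit_A v_orb.
rewrite leqNgt; apply/negP => n_gt3.
have y_decr p : (p < n)%N -> p.+1 != i -> y p.+1 < y p.
  by move=> pn /(v_pos (Ordinal pn)); rewrite def_v subr_gt0.
have no_chain p : y p.+1 < y p -> y p.+2 < y p.+1 -> False.
  by case: (val_y p) (val_y p.+1) (val_y p.+2) => -> [] -> [] ->; lra.
(* Among the first four descents only the one numbered [i] may fail, so the first two or the last
   two both hold. *)
by have [i2|i2] := leqP i 2;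
  [apply: (no_chain 2%N)|apply: (no_chain 0%N)]; apply: y_decr; lia.
Qed.

Lemma basic_system_B_rank n i j :
  (1 <= j <= n)%N -> basic_system R (TB n) i j -> (n <= 4)%N.
Proof.
move=> j_in /(basic_system_labels (t := TB n) j_in)[m m_gt0 [v v_orb v_pos]].
have [y def_v [c ty]] := label_orbit_B j_in v_orb.
rewrite leqNgt; apply/negP => n_gt4.
have y_decr p : (p.+1 < n)%N -> p.+1 != i -> y p.+1 < y p.
  move=> pn /(v_pos (Ordinal (ltnW pn))); rewrite def_v /=; decide_ifs.
  by rewrite subr_gt0.
(* If [i] is one of the last two nodes, the first four coordinates decrease. Otherwise the last two
   labels are positive, so the last two coordinates decrease and stay positive. *)
have [i_lt|i_ge] := ltnP i n.-1; last first.
  by apply: (@ternary_no_chain4 c y 0 ty); apply: y_decr; lia.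
have nP : (n.-2.+1 < n)%N by lia.
apply: (@ternary_no_chain2 c y n.-2 ty); last by apply: y_decr; lia.
have /(v_pos (Ordinal nP)) : n.-2.+2 != i by lia.
by rewrite def_v /=; decide_ifs; rewrite pmulr_rgt0.
Qed.

Lemma basic_system_C_rank n i j :
  (1 <= j <= n)%N -> basic_system R (TC n) i j -> (n <= 4)%N.
Proof.
move=> j_in /(basic_system_labels (t := TC n) j_in)[m m_gt0 [v v_orb v_pos]].
have [y def_v [c ty]] := label_orbit_C j_in v_orb.
rewrite leqNgt; apply/negP => n_gt4.
have y_decr p : (p.+1 < n)%N -> p.+1 != i -> y p.+1 < y p.
  move=> pn /(v_pos (Ordinal (ltnW pn))); rewrite def_v /=; decide_ifs.
  by rewrite subr_gt0.
have [i_lt|i_ge] := ltnP i n.-1; last first.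
  by apply: (@ternary_no_chain4 c y 0 ty); apply: y_decr; lia.
have nP : (n.-2.+1 < n)%N by lia.
apply: (@ternary_no_chain2 c y n.-2 ty); last by apply: y_decr; lia.
have /(v_pos (Ordinal nP)) : n.-2.+2 != i by lia.
by rewrite def_v /=; decide_ifs.
Qed.

Lemma basic_system_D_rank n i j :
  (1 <= j <= n)%N -> basic_system R (TD n) i j -> (n <= 5)%N.
Proof.
case: n => [|[|[|n]]] // j_in.
move=> /(basic_system_labels (t := TD n.+3) j_in)[m m_gt0 [v v_orb v_pos]].
have [y def_v [c ty]] := label_orbit_D (n := n.+1) j_in v_orb.
rewrite leqNgt; apply/negP => n_gt2.
have y_decr p : (p < n.+2)%N -> p.+1 != i -> y p.+1 < y p.
  move=> pn /(v_pos (Ordinal (leqW pn))); rewrite def_v /=; decide_ifs.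
  by rewrite subr_gt0.
have [i_lt|i_ge] := ltnP i n.+1; last first.
  by apply: (@ternary_no_chain4 c y 0 ty); apply: y_decr; lia.
apply: (@ternary_no_chain2 c y n ty); last by apply: y_decr; lia.
(* The larger of two reals with positive sum is positive. *)
have y_lt : y n.+2 < y n.+1 by apply: y_decr; lia.
have /(v_pos ord_max) : n.+3 != i by lia.
by rewrite def_v /= eqxx => ?; lra.
Qed.
End Coordinates.

(* The inverse Cartan matrices of E6, E7, E8 times 3, 2, 1 respectively. *)
Definition inv_cartan_E6 : seq (seq int) :=
 [:: [:: 4; 3; 5; 6; 4; 2];
    [:: 3; 6; 6; 9; 6; 3];
    [:: 5; 6; 10; 12; 8; 4];
    [:: 6; 9; 12; 18; 12; 6];
    [:: 4; 6; 8; 12; 10; 5];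
    [:: 2; 3; 4; 6; 5; 4]].

Definition inv_cartan_E7 : seq (seq int) :=
  [:: [:: 4; 4; 6; 8; 6; 4; 2];
    [:: 4; 7; 8; 12; 9; 6; 3];
    [:: 6; 8; 12; 16; 12; 8; 4];
    [:: 8; 12; 16; 24; 18; 12; 6];
    [:: 6; 9; 12; 18; 15; 10; 5];
    [:: 4; 6; 8; 12; 10; 8; 4];
    [:: 2; 3; 4; 6; 5; 4; 3]].

Definition inv_cartan_E8 : seq (seq int) :=
  [:: [:: 4; 5; 7; 10; 8; 6; 4; 2];
    [:: 5; 8; 10; 15; 12; 9; 6; 3];
    [:: 7; 10; 14; 20; 16; 12; 8; 4];
    [:: 10; 15; 20; 30; 24; 18; 12; 6];
    [:: 8; 12; 16; 24; 20; 15; 10; 5];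
    [:: 6; 9; 12; 18; 15; 12; 8; 4];
    [:: 4; 6; 8; 12; 10; 8; 6; 3];
    [:: 2; 3; 4; 6; 5; 4; 3; 2]].

(** * Assembly of the finitely many remaining cases *)

Definition rank_pairs (r : nat) : seq (nat * nat) :=
  [seq (i, j) | i <- iota 1 r, j <- iota 1 r].

(** Common interface to both exclusion tests: for a sound test, only the pairs it leaves must be
    looked up in the list. *)
Lemma basic_system_in_list (R : realFieldType) (t : cartan_type)
    (excl : nat -> nat -> bool) (i j : nat) :
  (forall i j, (1 <= i <= rank t)%N -> (1 <= j <= rank t)%N ->
     excl i j -> ~ basic_system R t i j) ->
  List.Forall (fun ij => List.In (t, ij.1, ij.2) basic_list)
    [seq ij <- rank_pairs (rank t) | ~~ excl ij.1 ij.2] ->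
  (1 <= i <= rank t)%N -> (1 <= j <= rank t)%N -> basic_system R t i j ->
  List.In (t, i, j) basic_list.
Proof.
move=> sound in_basic i_in j_in ij_basic.
have: (i, j) \in [seq ij <- rank_pairs (rank t) | ~~ excl ij.1 ij.2].
  rewrite mem_filter /=.
  have [/(sound _ _ i_in j_in)//|_ /=] := boolP (excl i j).
  by apply: allpairs_f; rewrite mem_iota add1n ltnS.
elim: in_basic => //= ij s ij_in _ IHs /predU1P[def_ij|/IHs//].
by rewrite -def_ij in ij_in.
Qed.

Ltac in_list := first [left; reflexivity | right; in_list].

Ltac check_pairs :=
  match goal with |- List.Forall _ ?l =>
    let s := eval vm_compute in l in
    have -> : l = s by vm_cast_no_check (erefl s)
  end;
  repeat (apply: List.Forall_cons; first by in_list); exact: List.Forall_nil.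

Ltac by_orbit H :=
  apply: (@basic_system_in_list _ _ (orbit_excludes _) _ _ _ _ _ _ H) =>
    // [? ? _|]; [exact: orbit_excludes_sound | check_pairs].

Ltac by_norm d g H :=
  apply: (@basic_system_in_list _ _
      (fun i j => norm_excludes _ d g i.-1 j.-1) _ _ _ _ _ _ H) => // [? ?|];
    [exact: norm_excludes_sound | check_pairs].

Theorem theorem5p5 (R : realFieldType) (t : cartan_type) (i j : nat) :
  valid_type t ->
  (1 <= i <= rank t)%N -> (1 <= j <= rank t)%N ->
  basic_system R t i j ->
  List.In (t, i, j) basic_list.
Proof.
case: t => [n|n|n|n|||||] /= t_valid i_in j_in ij_basic.
- move: (basic_system_A_rank j_in ij_basic) => n_le.
  by case: n => [|[|[|[|n]]]] // in t_valid i_in j_in ij_basic n_le *; by_orbit ij_basic.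
- move: (basic_system_B_rank j_in ij_basic) => n_le.
  by case: n => [|[|[|[|[|n]]]]] // in t_valid i_in j_in ij_basic n_le *; by_orbit ij_basic.
- move: (basic_system_C_rank j_in ij_basic) => n_le.
  by case: n => [|[|[|[|[|n]]]]] // in t_valid i_in j_in ij_basic n_le *; by_orbit ij_basic.
- move: (basic_system_D_rank j_in ij_basic) => n_le.
  by case: n => [|[|[|[|[|[|n]]]]]] // in t_valid i_in j_in ij_basic n_le *; by_orbit ij_basic.
- by_norm (3 : int) inv_cartan_E6 ij_basic.
- by_norm (2 : int) inv_cartan_E7 ij_basic.
- by_norm (1 : int) inv_cartan_E8 ij_basic.
- by_orbit ij_basic.
- by_orbit ij_basic.
Qed.
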